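(* Let $G$ be a graph on $n \geq 2$ vertices. Let $G_0 = G$, and for $j = 0, \ldots, n-3$ let $G_{j+1}$ be obtained from $G_j$ by deleting a vertex $v_{1,j}$ of maximum degree $d_{1,j}$ in $G_j$. For each $j$ let $d_{2,j}$ be the second largest degree in $G_j$ (the second term of the non-increasing degree sequence of $G_j$, counted with multiplicity), so that $\operatorname{diff}(G_j) = d_{1,j} - d_{2,j}$. Then \[ f(G) = \min\{\operatorname{diff}(G_j) + j : j = 0, \ldots, n-2\}. \] Moreover, $f(G)$ can be determined in time $O(n^2)$.
   Context: All graphs are finite and simple. For a graph $G$, $f(G) = f_2(G)$ denotes the minimum number of vertices that must be deleted from $G$ to obtain an induced subgraph $H$ in which at least two vertices have degree $\Delta(H)$ (the maximum degree of $H$), or otherwise $|H| < 2$, where $|H|$ is the number of vertices of $H$. For a graph with at least two vertices and degree sequence $d_1 \geq d_2 \geq \cdots \geq d_n$, $\operatorname{diff}(G) = d_1 - d_2$. *)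

(* Defs.v *)
From mathcomp Require Import all_boot.

Set Implicit Arguments.
Unset Strict Implicit.
Unset Printing Implicit Defensive.

(* A finite simple graph is a symmetric irreflexive relation e on a finType;  *)
(* its induced subgraphs are represented by their vertex sets S.              *)

Definition simple_graph (T : finType) (e : rel T) : Prop :=
  symmetric e /\ irreflexive e.

Section Degrees.
Variables (T : finType) (e : rel T).
Implicit Type S : {set T}.

Definition deg S (v : T) : nat := #|[set u in S | e v u]|.

Definition maxdeg S : nat := \max_(v in S) deg S v.

Definition degree_sequence S : seq nat := sort geq [seq deg S v | v in S].

(* Meaningful for 2 <= #|S|; the subtraction of naturals is then exact since  *)
(* the sequence is non-increasing.                                            *)
Definition diff S : nat :=
  nth 0 (degree_sequence S) 0 - nth 0 (degree_sequence S) 1.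

Definition two_max_degree S : bool :=
  (1 < #|[set v in S | deg S v == maxdeg S]|) || (#|S| < 2).

(* D ranges over the sets of deleted vertices; D = [set: T] is admissible     *)
(* because the empty graph has fewer than two vertices.                       *)
Definition f2 : nat :=
  #|[arg min_(D < [set: T] | two_max_degree (~: D)) #|D|]|.

End Degrees.

(* Running time is measured on a unit-cost word RAM with addition, truncated  *)
(* subtraction, comparison and indirect addressing, with structured control   *)
(* flow.  Operands are register numbers, except for the second operand of     *)
(* Const, which is a literal.                                                 *)

Inductive instr : Type :=
  | Const of nat & nat
  | Add of nat & nat & nat
  | Sub of nat & nat & nat
  | LoadMem of nat & nat
  | StoreMem of nat & nat.

Inductive cmd : Type :=
  | Skip
  | Instr of instr
  | Seq of cmd & cmd
  | IfLt of nat & nat & cmd & cmd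
  | WhileLt of nat & nat & cmd.

Record state : Type := State { reg : nat -> nat; mem : nat -> nat }.

Definition upd (g : nat -> nat) (a b : nat) : nat -> nat :=
  fun x => if x == a then b else g x.

(* A machine word holds a natural number smaller than W; the machine gets     *)
(* stuck on overflow, so that unit-cost arithmetic on huge numbers cannot be  *)
(* exploited.                                                                 *)
Definition write_reg (W : nat) (s : state) (x a : nat) : option state :=
  if a < W then Some (State (upd (reg s) x a) (mem s)) else None.

Definition exec_instr (W : nat) (i : instr) (s : state) : option state :=
  match i with
  | Const x a => write_reg W s x a
  | Add x y z => write_reg W s x (reg s y + reg s z)
  | Sub x y z => write_reg W s x (reg s y - reg s z)
  | LoadMem x y => write_reg W s x (mem s (reg s y))
  | StoreMem x y => Some (State (reg s) (upd (mem s) (reg s x) (reg s y)))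
  end.

(* exec W c s t s': started in s, the command c terminates in s' after        *)
(* exactly t elementary steps (instructions and tests).                       *)
Inductive exec (W : nat) : cmd -> state -> nat -> state -> Prop :=
  | exec_skip s : exec W Skip s 1 s
  | exec_one i s s' : exec_instr W i s = Some s' -> exec W (Instr i) s 1 s'
  | exec_seq c1 c2 s1 s2 s3 t1 t2 :
      exec W c1 s1 t1 s2 -> exec W c2 s2 t2 s3 ->
      exec W (Seq c1 c2) s1 (t1 + t2) s3
  | exec_if_true x y c1 c2 s s' t :
      reg s x < reg s y -> exec W c1 s t s' ->
      exec W (IfLt x y c1 c2) s t.+1 s'
  | exec_if_false x y c1 c2 s s' t :
      ~~ (reg s x < reg s y) -> exec W c2 s t s' ->
      exec W (IfLt x y c1 c2) s t.+1 s'
  | exec_while_true x y c s1 s2 s3 t1 t2 :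
      reg s1 x < reg s1 y -> exec W c s1 t1 s2 ->
      exec W (WhileLt x y c) s2 t2 s3 ->
      exec W (WhileLt x y c) s1 (t1 + t2).+1 s3
  | exec_while_false x y c s :
      ~~ (reg s x < reg s y) -> exec W (WhileLt x y c) s 1 s.

(* Input: n in register 0 and the adjacency matrix, row by row, in memory     *)
(* cells 0, ..., n ^ 2 - 1; all other registers and cells contain 0.          *)
Definition graph_input (n : nat) (e : rel 'I_n) : state :=
  State (fun x => if x == 0 then n else 0)
        (fun a => [exists i : 'I_n, exists j : 'I_n, (a == i * n + j) && e i j] : nat).

(* The parameter F of graphs is computed, for n >= 2 vertices, by a single    *)
(* program in time O(n ^ 2) with words of at most k * log2 n bits; the output *)
(* is read in register 0.                                                     *)
Definition computable_in_quadratic_time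
    (F : forall n : nat, rel 'I_n -> nat) : Prop :=
  exists (p : cmd) (c k : nat),
    forall (n : nat) (e : rel 'I_n), 1 < n -> simple_graph e ->
      exists (t : nat) (s : state),
        [/\ exec (n ^ k) p (graph_input e) t s, t <= c * n ^ 2
          & reg s 0 = F n e].

(* Main.v *)
Require Import Defs.
From mathcomp Require Import all_boot zify.

Set Implicit Arguments.
Unset Strict Implicit.
Unset Printing Implicit Defensive.

(** Both halves of the theorem rest on one recurrence.  Write [mindel S] for
    the least number of vertices to delete from the subgraph induced by [S] so
    that the maximum degree is attained twice or fewer than two vertices
    remain.  If [S] has at least two vertices and [v] has maximum degree in it,
    then ([mindel_rec])
      [mindel S = minn (diff S) (mindel (S :\ v)).+1].
    An optimal deletion that removes [v] is [v] together with a deletion in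
    [S :\ v].  One that keeps [v] has at least [diff S] elements
    ([diff_le_deletion]): another surviving vertex [z] must catch up with [v];
    the degree of [z] is at most the second largest degree from the start, so
    that of [v] has to drop by [diff S], and each deletion lowers it by at most
    one.  (If [v] survives alone, [#|S| - 1] vertices are gone, which exceeds
    [diff S] by [diff_le].)  Conversely [diff S] deletions suffice ([mindel_le_diff]): if [w] has
    the second largest degree, then [v] has at least [diff S] neighbours,
    other than [w], which are not adjacent to [w]; deleting [diff S] of them
    brings [v] down to the degree of [w], which does not change, and no other
    vertex exceeds it.

    Unrolling the recurrence along the sequence of greedy deletions gives the
    formula ([f2_greedy]).  It stops at two vertices, where [diff] and [mindel]
    both vanish.

    The program follows the same recurrence.  Behind the adjacency matrix it
    keeps an array with the entry [d + 1] for a remaining vertex of degree [d]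
    and [0] for a deleted one.  One pass over the array finds the two largest
    entries, whose difference is [diff], and the position [v] of the first; a
    second pass subtracts column [v] of the matrix from the array.  Each of the
    [n - 1] rounds is linear, and computing the degrees is quadratic.  The
    loop invariant ([greedy_inv]) says that after [k] rounds, with [S] left,
      [minn best (mindel S + k) = f2 e],
    and one round preserves it by [mindel_rec]. *)

(** * Deleting vertices one maximum at a time *)

Section Graph.
Variables (T : finType) (e : rel T).
Hypothesis simple_e : simple_graph e.
Implicit Types (S D H : {set T}) (u v w : T).

Lemma deg_max S v : deg e S v = maxdeg e S -> {in S, forall u, deg e S u <= deg e S v}.
Proof. by move=> -> u uS; apply: (@leq_bigmax_cond _ (mem S) (deg e S)). Qed.

Lemma exists_maxdeg S : 0 < #|S| -> exists2 v, v \in S & deg e S v = maxdeg e S.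
Proof.
move=> S_gt0; have [v vS Ev] := @eq_bigmax_cond _ (mem S) (deg e S) S_gt0.
by exists v; rewrite // /maxdeg -Ev.
Qed.

Lemma maxdegP S v :
  v \in S -> {in S, forall u, deg e S u <= deg e S v} -> deg e S v = maxdeg e S.
Proof.
move=> vS vmax; apply/eqP; rewrite eqn_leq; apply/andP; split.
  exact: (@leq_bigmax_cond _ (mem S) (deg e S)).
by apply/bigmax_leqP => u /vmax.
Qed.

(** Reads [diff] off any two vertices of largest degrees, so that nothing else
    has to look inside the sorted degree sequence. *)
Lemma diff_two_largest S v w :
    v \in S -> w \in S :\ v ->
    {in S, forall u, deg e S u <= deg e S v} ->
    {in S :\ v, forall u, deg e S u <= deg e S w} ->
  diff e S = deg e S v - deg e S w.
Proof.
move=> vS wSv vmax wmax.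
have /andP[wv wS] : (w != v) && (w \in S) by move: wSv; rewrite !inE.
pose s := enum (S :\ v :\ w).
have geq_trans : transitive geq by move=> a b c /= ab bc; apply: leq_trans bc ab.
have geq_total : total geq by move=> a b; apply: leq_total.
have geq_anti : antisymmetric geq by move=> a b; rewrite /geq /= andbC -eqn_leq => /eqP.
have enumS : perm_eq (enum S) [:: v, w & s].
  apply: uniq_perm; rewrite ?enum_uniq //=.
    by rewrite !inE negb_or eq_sym wv !mem_enum !inE !eqxx enum_uniq !andbF.
  move=> u; rewrite !inE !mem_enum !inE.
  by case: eqVneq => [->|_] //=; case: eqVneq => [->|_].
have seqE : degree_sequence e S
            = [:: deg e S v, deg e S w & sort geq (map (deg e S) s)].
  have sorted2 : sorted geq [:: deg e S v, deg e S w & sort geq (map (deg e S) s)].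
    have dmin : all (geq (deg e S w)) (sort geq (map (deg e S) s)).
      apply/allP => d; rewrite mem_sort => /mapP[u]; rewrite mem_enum inE => /andP[_ uS] ->.
      exact: wmax.
    by rewrite /= vmax //= path_min_sorted ?sort_sorted.
  rewrite /degree_sequence; apply: (sorted_eq geq_trans geq_anti) sorted2 _.
    exact: sort_sorted.
  rewrite perm_sort; apply: perm_trans (perm_map _ enumS) _ => /=.
  by rewrite !perm_cons perm_sym perm_sort.
by rewrite /diff seqE.
Qed.

Lemma diff_witness S v :
    v \in S -> deg e S v = maxdeg e S -> 1 < #|S| ->
  exists2 w, w \in S :\ v
           & {in S :\ v, forall u, deg e S u <= deg e S w}
             /\ diff e S = deg e S v - deg e S w.
Proof.
move=> vS /deg_max vmax S_gt1.
have S1_gt0 : 0 < #|S :\ v| by rewrite (cardsD1 v) vS in S_gt1.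
have [w wSv Ew] := @eq_bigmax_cond _ (mem (S :\ v)) (deg e S) S1_gt0.
have wmax : {in S :\ v, forall u, deg e S u <= deg e S w}.
  by move=> u uS; rewrite -Ew (@leq_bigmax_cond _ (mem (S :\ v)) (deg e S)).
by exists w => //; split=> //; apply: diff_two_largest.
Qed.

(** The vertices whose deletion lowers the degree of [v] but not that of [w],
    without deleting [w]. *)
Definition private_nbrs S v w := [set u in S :\ w | e v u & ~~ e w u].

(** The common neighbours cancel, and so do [v] and [w] themselves: if adjacent,
    each counts once for the other. *)
Lemma deg_sub_private S v w :
  v \in S -> w \in S -> deg e S v - deg e S w <= #|private_nbrs S v w|.
Proof.
case: simple_e => sym_e irr_e vS wS.
pose N x := [set u in S | e x u].
have splitN : N v :\ w = (N v :&: N w) :|: private_nbrs S v w.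
  apply/setP=> u; rewrite !inE; case: (u \in S) => //=; rewrite ?andbF //=.
  by case: eqVneq => [->|_] /=; rewrite ?irr_e ?andbF //=; case: (e v u); case: (e w u).
have lev : #|N v :\ w| <= #|N v :&: N w| + #|private_nbrs S v w|.
  by rewrite splitN cardsU leq_subr.
have : #|N v :&: N w| <= #|N w :\ v|.
  apply/subset_leq_card/subsetP => u; rewrite !inE => /and3P[/andP[-> evu] _ ->].
  by rewrite !andbT; apply: contraTneq evu => ->; rewrite irr_e.
have := cardsD1 w (N v); have := cardsD1 v (N w).
rewrite !inE vS wS sym_e /deg -/(N v) -/(N w); lia.
Qed.

Lemma card_private S v w : v \in S -> w \in S :\ v -> #|private_nbrs S v w| <= #|S| - 2.
Proof.
case: simple_e => sym_e irr_e vS; rewrite !inE => /andP[wv wS].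
have -> : #|S| - 2 = #|S :\ v :\ w|.
  by rewrite (cardsD1 v S) (cardsD1 w (S :\ v)) !inE vS wv wS /=; lia.
apply/subset_leq_card/subsetP => u; rewrite !inE => /andP[/andP[-> ->] /andP[evu _]].
by rewrite !andbT /=; apply: contraTneq evu => ->; rewrite irr_e.
Qed.

(** The private neighbours of the vertex of largest degree avoid it and the
    second one. *)
Lemma diff_le S : 1 < #|S| -> diff e S <= #|S| - 2.
Proof.
move=> S_gt1; have [v vS vmax] := exists_maxdeg (ltnW S_gt1).
have [w wS [_ ->]] := diff_witness vS vmax S_gt1.
apply: leq_trans (card_private vS wS); apply: deg_sub_private => //.
by move: wS; rewrite inE => /andP[].
Qed.

(** [f2] of the subgraph induced by [S], deletions being counted inside [S]:
    the form in which the parameter can be followed through deletions. *)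
Definition mindel S : nat :=
  #|[arg min_(D < S | (D \subset S) && two_max_degree e (S :\: D)) #|D|]|.

Lemma two_max_degree_small H : #|H| < 2 -> two_max_degree e H.
Proof. by rewrite /two_max_degree orbC => ->. Qed.

Lemma mindelP S :
  (exists D, [/\ D \subset S, two_max_degree e (S :\: D) & #|D| = mindel S])
  /\ (forall D, D \subset S -> two_max_degree e (S :\: D) -> mindel S <= #|D|).
Proof.
rewrite /mindel; case: arg_minnP => [|D /andP[DS D2] Dmin].
  by rewrite subxx setDv two_max_degree_small // cards0.
by split=> [|D' D'S D'2]; [exists D | apply: Dmin; rewrite D'S].
Qed.

Lemma f2_mindel : f2 e = mindel [set: T].
Proof.
rewrite /f2; case: arg_minnP => [|D D2 Dmin].
  by rewrite setCT two_max_degree_small // cards0.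
have [[D' [_ D'2 D'E]] mindel_le] := mindelP [set: T].
apply/eqP; rewrite eqn_leq; apply/andP; split.
  by rewrite -D'E Dmin // -setTD.
by apply: mindel_le; rewrite ?subsetT ?setTD.
Qed.

Lemma deg_setD S D x :
  D \subset S -> deg e (S :\: D) x + #|[set u in D | e x u]| = deg e S x.
Proof.
move=> DS; rewrite /deg -(cardsID D [set u in S | e x u]) addnC; congr (_ + _).
  apply: eq_card => u; rewrite !inE andbAC.
  by case: (boolP (u \in D)) => [/(subsetP DS)->|]; rewrite ?andbF.
by apply: eq_card => u; rewrite !inE andbA.
Qed.

(** Deleting [diff e S] private neighbours of the vertex of largest degree
    levels it with the second one. *)
Lemma mindel_le_diff S : 1 < #|S| -> mindel S <= diff e S.
Proof.
move=> S_gt1; have [v vS vmax] := exists_maxdeg (ltnW S_gt1).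
have [w wSv [wmax diffS]] := diff_witness vS vmax S_gt1.
have /andP[wv wS] : (w != v) && (w \in S) by move: wSv; rewrite !inE.
have := deg_sub_private vS wS; rewrite -diffS => /card_geqP[d [d_uniq d_size d_sub]].
(* card_geqP picks exactly diff e S private neighbours, listed in d. *)
pose D := [set u in d].
have D_priv u : u \in D -> [/\ u != w, u \in S, e v u & ~~ e w u].
  by rewrite inE => /d_sub; rewrite !inE => /andP[/andP[-> ->] /andP[-> ->]].
have cardD : #|D| = diff e S by rewrite cardsE (card_uniqP d_uniq).
have DS : D \subset S by apply/subsetP => u /D_priv[].
have DvE : [set u in D | e v u] = D.
  by apply/setP=> u; rewrite [LHS]inE; apply/andb_idr => /D_priv[].
have DwE : [set u in D | e w u] = set0.
  by apply/setP=> u; rewrite [LHS]inE in_set0; apply/negP=> /andP[/D_priv[_ _ _ /negP]].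
have degv := deg_setD v DS; rewrite DvE cardD in degv.
have degw := deg_setD w DS; rewrite DwE cards0 addn0 in degw.
have vw_le := deg_max vmax wS.
have degvw : deg e (S :\: D) v = deg e (S :\: D) w by lia.
have vH : v \in S :\: D.
  by rewrite inE vS andbT; apply/negP => /D_priv[_ _]; case: simple_e => _ ->.
have wH : w \in S :\: D by rewrite inE wS andbT; apply/negP => /D_priv[/eqP].
have wmaxH : deg e (S :\: D) w = maxdeg e (S :\: D).
  apply: maxdegP => // u; rewrite inE => /andP[_ uS].
  have [->|uv] := eqVneq u v; first by rewrite degvw.
  have := wmax u; rewrite !inE uv uS => /(_ isT).
  by have := deg_setD u DS; lia.
rewrite -cardD; apply: (mindelP S).2 => //; apply/orP; left.
have <- : #|[set v; w]| = 2 by rewrite cards2 eq_sym wv.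
apply/subset_leq_card/subsetP => u; rewrite !inE.
move: vH wH; rewrite !inE => /andP[vD _] /andP[wD _].
by case/orP => /eqP->; rewrite ?vD ?wD ?vS ?wS /= -?degvw -wmaxH ?degvw ?eqxx.
Qed.

(** If [v] survives, its degree must fall to that of another survivor, which
    never exceeded the second largest degree; every deletion costs [v] at most
    one neighbour. *)
Lemma diff_le_deletion S v D :
    1 < #|S| -> v \in S -> deg e S v = maxdeg e S ->
    D \subset S -> v \notin D -> two_max_degree e (S :\: D) ->
  diff e S <= #|D|.
Proof.
move=> S_gt1 vS vmax DS vD H2.
have vH : v \in S :\: D by rewrite inE vD.
case/orP: H2 => [/card_gt1P[x [y [xM yM xy]]] | H_lt2]; last first.
  by have := diff_le S_gt1; have := cardsD S D; rewrite (setIidPr DS); lia.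
have [z zv zM] : exists2 z,
    z != v & z \in [set u in S :\: D | deg e (S :\: D) u == maxdeg e (S :\: D)].
  by have [xv|] := eqVneq x v; [exists y; rewrite // -xv eq_sym | exists x].
move: zM; rewrite inE => /andP[zH /eqP zmax].
have zS : z \in S by move: zH; rewrite inE => /andP[].
have [w wS [wmax ->]] := diff_witness vS vmax S_gt1.
have := wmax z; rewrite !inE zv zS => /(_ isT).
have := deg_max zmax vH; have := deg_setD z DS; have := deg_setD v DS.
have : #|[set u in D | e v u]| <= #|D|.
  by apply/subset_leq_card/subsetP => u; rewrite inE => /andP[].
lia.
Qed.

(** An optimal deletion either removes [v] or keeps it. *)
Lemma mindel_rec S v :
    1 < #|S| -> v \in S -> deg e S v = maxdeg e S ->
  mindel S = minn (diff e S) (mindel (S :\ v)).+1.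
Proof.
move=> S_gt1 vS vmax; apply/eqP; rewrite eqn_leq leq_min mindel_le_diff //=.
apply/andP; split.
  have [[D [DS D2 <-]] _] := mindelP (S :\ v).
  have vD : v \notin D by apply/negP=> /(subsetP DS); rewrite !inE eqxx.
  have <- : #|v |: D| = #|D|.+1 by rewrite cardsU1 vD.
  apply: (mindelP S).2; last by rewrite -setDDl.
  by rewrite subUset sub1set vS; apply: subset_trans DS (subsetDl _ _).
have [[D [DS D2 <-]] _] := mindelP S.
rewrite geq_min; have [vD|vD] := boolP (v \in D); last first.
  by rewrite (@diff_le_deletion S v D).
rewrite (cardsD1 v D) vD ltnS (mindelP (S :\ v)).2 ?orbT ?setSD //.
by rewrite setDDl setD1K.
Qed.

End Graph.

Lemma f2_greedy (T : finType) (e : rel T) (G : nat -> {set T}) (v : nat -> T) :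
    simple_graph e -> 2 <= #|T| -> G 0 = [set: T] ->
    (forall j, j + 3 <= #|T| ->
       [/\ v j \in G j, deg e (G j) (v j) = maxdeg e (G j)
         & G j.+1 = G j :\ v j]) ->
  f2 e = \big[minn/diff e (G 0) + 0]_(0 <= j < #|T| - 1) (diff e (G j) + j).
Proof.
move=> simple_e T_ge2 G0 Gstep.
have cardG j : j + 2 <= #|T| -> #|G j| = #|T| - j.
  elim: j => [|j IHj] jT; first by rewrite G0 cardsT subn0.
  have [|vG _ ->] := Gstep j; first lia.
  have := cardsD1 (v j) (G j); rewrite vG IHj; lia.
(* The tail of the minimum from j on computes mindel of G j.  The initial term
   diff e (G 0) is carried along, and is absorbed at j = 0. *)
have tailE d j : d + j + 2 = #|T| ->
  \big[minn/diff e (G 0) + 0]_(j <= i < #|T| - 1) (diff e (G i) + i)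
    = minn (mindel e (G j) + j) (diff e (G 0) + 0).
  elim: d j => [|d IHd] j dT; rewrite big_ltn; try lia.
    (* On two vertices diff is at most 0, hence so is mindel. *)
    rewrite big_geq; last lia.
    have Gj2 : #|G j| = 2 by rewrite cardG; lia.
    have := diff_le simple_e (S := G j); have := mindel_le_diff simple_e (S := G j).
    by rewrite Gj2 => /(_ isT) + /(_ isT); lia.
  rewrite IHd; last lia.
  have [|vG vmax GS] := Gstep j; first lia.
  rewrite (mindel_rec simple_e _ vG vmax) -?GS; first lia.
  by rewrite cardG; lia.
rewrite f2_mindel -G0 (tailE (#|T| - 2)) ?addn0; last lia.
apply/esym/minn_idPl/mindel_le_diff => //; rewrite cardG; lia.
Qed.

(** * A cost logic for the word RAM *)

(** Hoare triples with a time bound [t] instead of an exact running time, so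
    that the two branches of a test can share one bound. *)
Definition runs (W : nat) (c : cmd) (s : state) (t : nat) (P : state -> Prop) :=
  exists t' s', [/\ exec W c s t' s', t' <= t & P s'].

Section Rules.
Variable W : nat.
Implicit Types (c : cmd) (s : state) (t : nat) (P Q : state -> Prop).

Lemma runs_skip s t P : P s -> runs W Skip s t.+1 P.
Proof. by exists 1, s; split=> //; constructor. Qed.

Lemma runs_impl c s t P Q : (forall s', P s' -> Q s') -> runs W c s t P -> runs W c s t Q.
Proof. by move=> PQ [u [s' [ex ut /PQ Qs]]]; exists u, s'. Qed.

Lemma runs_seq c1 c2 s t1 t2 P Q :
    runs W c1 s t1 P -> (forall s', P s' -> runs W c2 s' t2 Q) ->
  runs W (Seq c1 c2) s (t1 + t2) Q.
Proof.
move=> [u1 [s1 [ex1 u1t Ps1]]] /(_ s1 Ps1) [u2 [s2 [ex2 u2t Qs2]]].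
by exists (u1 + u2), s2; split=> //; [apply: exec_seq ex1 ex2 | lia].
Qed.

Lemma runs_instr i c s s' t P :
    exec_instr W i s = Some s' -> runs W c s' t P ->
  runs W (Seq (Instr i) c) s t.+1 P.
Proof.
move=> exi runsc; rewrite -add1n.
by apply: (runs_seq (P := eq s')) => [|_ <- //]; exists 1, s'; split=> //; constructor.
Qed.

(** The first premise holds by computation for every instruction except
    [StoreMem]; the second is the only place where overflow is an issue. *)
Lemma runs_write i x a c s t P :
    exec_instr W i s = write_reg W s x a -> a < W ->
    runs W c (State (upd (reg s) x a) (Defs.mem s)) t P ->
  runs W (Seq (Instr i) c) s t.+1 P.
Proof. by move=> exi aW; apply: runs_instr; rewrite exi /write_reg aW. Qed.

Lemma runs_if x y c1 c2 s t P :
    (reg s x < reg s y -> runs W c1 s t P) ->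
    (reg s y <= reg s x -> runs W c2 s t P) ->
  runs W (IfLt x y c1 c2) s t.+1 P.
Proof.
move=> runs1 runs2; have [xy|yx] := ltnP (reg s x) (reg s y).
  have [u [s' [ex ut Ps]]] := runs1 xy.
  by exists u.+1, s'; split=> //; apply: exec_if_true.
have [u [s' [ex ut Ps]]] := runs2 yx.
by exists u.+1, s'; split=> //; apply: exec_if_false; rewrite // -leqNgt.
Qed.

(** The invariant ties the counter to the index, so the number of rounds is
    known and the loop costs that of [N] bodies and [N + 1] tests. *)
Lemma runs_for x y c N t (I : nat -> state -> Prop) s :
    (forall k s, I k s -> reg s x = k /\ reg s y = N) ->
    (forall k s, k < N -> I k s -> runs W c s t (I k.+1)) ->
  I 0 s -> runs W (WhileLt x y c) s (N * t.+1).+1 (I N).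
Proof.
move=> counter body.
suff loop d k s' : k + d = N -> I k s' -> runs W (WhileLt x y c) s' (d * t.+1).+1 (I N).
  exact: loop.
elim: d k s' => [|d IHd] k s' kN Ik; have [xk yN] := counter k s' Ik.
  exists 1, s'; rewrite -kN addn0 in Ik *.
  by split=> //; apply: exec_while_false; rewrite xk yN; lia.
have kltN : k < N by lia.
have [u1 [s1 [ex1 u1t Is1]]] := body k s' kltN Ik.
have [|u2 [s2 [ex2 u2t Is2]]] := IHd k.+1 s1 _ Is1; first lia.
exists (u1 + u2).+1, s2; split=> //; last lia.
by apply: exec_while_true ex1 ex2; rewrite xk yN.
Qed.
End Rules.

(** * The program *)

Local Infix ";;" := Seq (at level 61, right associativity).
Local Coercion Instr : instr >-> cmd.

(** [last] holds [n - 1], [base] the address [n * n] of the array that follows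
    the matrix, [row] a multiple of [n] updated by additions; [zero] is never
    written and serves to copy registers. *)
Module Reg.
Notation n := 0.
Notation one := 1.
Notation last := 2.
Notation base := 3.
Notation outer := 4.
Notation inner := 5.
Notation row := 6.
Notation addr := 7.
Notation val := 8.
Notation top := 9.
Notation second := 10.
Notation arg := 11.
Notation best := 12.
Notation aux := 13.
Notation zero := 14.
End Reg.

Definition square_loop : cmd :=
  WhileLt Reg.outer Reg.n
    (Add Reg.base Reg.base Reg.n ;; Add Reg.outer Reg.outer Reg.one ;; Skip).

Definition row_sum_loop : cmd :=
  WhileLt Reg.inner Reg.n
    (Add Reg.addr Reg.row Reg.inner ;; LoadMem Reg.aux Reg.addr ;;
     Add Reg.val Reg.val Reg.aux ;; Add Reg.inner Reg.inner Reg.one ;; Skip).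

Definition degree_loop : cmd :=
  WhileLt Reg.outer Reg.n
    (* Starting at 1 shifts the degrees, so that 0 can mark deleted vertices. *)
    (Const Reg.val 1 ;; Const Reg.inner 0 ;; row_sum_loop ;;
     Add Reg.addr Reg.base Reg.outer ;; StoreMem Reg.addr Reg.val ;;
     Add Reg.row Reg.row Reg.n ;; Add Reg.outer Reg.outer Reg.one ;; Skip).

Definition scan_loop : cmd :=
  WhileLt Reg.inner Reg.n
    (Add Reg.addr Reg.base Reg.inner ;; LoadMem Reg.val Reg.addr ;;
     IfLt Reg.top Reg.val
       (Add Reg.second Reg.top Reg.zero ;; Add Reg.top Reg.val Reg.zero ;;
        Add Reg.arg Reg.inner Reg.zero ;; Skip)
       (IfLt Reg.second Reg.val (Add Reg.second Reg.val Reg.zero ;; Skip) Skip) ;;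
     Add Reg.inner Reg.inner Reg.one ;; Skip).

(** Subtraction is truncated, so the entries 0 of deleted vertices stay 0 and
    no test is needed.  By symmetry the column of [arg] can be read instead of
    its row, whose first address [arg * n] would need a multiplication. *)
Definition update_loop : cmd :=
  WhileLt Reg.inner Reg.n
    (Add Reg.addr Reg.row Reg.arg ;; LoadMem Reg.val Reg.addr ;;
     Add Reg.addr Reg.base Reg.inner ;; LoadMem Reg.aux Reg.addr ;;
     Defs.Sub Reg.aux Reg.aux Reg.val ;; StoreMem Reg.addr Reg.aux ;;
     Add Reg.row Reg.row Reg.n ;; Add Reg.inner Reg.inner Reg.one ;; Skip).

Definition greedy_loop : cmd :=
  WhileLt Reg.outer Reg.last
    (Const Reg.top 0 ;; Const Reg.second 0 ;; Const Reg.inner 0 ;; scan_loop ;;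
     Defs.Sub Reg.val Reg.top Reg.second ;; Add Reg.val Reg.val Reg.outer ;;
     IfLt Reg.val Reg.best (Add Reg.best Reg.val Reg.zero ;; Skip) Skip ;;
     Const Reg.row 0 ;; Const Reg.inner 0 ;; update_loop ;;
     Add Reg.addr Reg.base Reg.arg ;; StoreMem Reg.addr Reg.zero ;;
     Add Reg.outer Reg.outer Reg.one ;; Skip).

(** The initial value [n - 1] of [best] is a bound on [f2]: one vertex may be
    left. *)
Definition f2_program : cmd :=
  Const Reg.one 1 ;; square_loop ;;
  Const Reg.outer 0 ;; degree_loop ;;
  Defs.Sub Reg.last Reg.n Reg.one ;; Add Reg.best Reg.last Reg.zero ;;
  Const Reg.outer 0 ;; greedy_loop ;;
  Add Reg.n Reg.best Reg.zero ;; Skip.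

(** * Graphs laid out in memory *)

(** [d1] and [d2] are the two largest among the first [k] values of [D], with
    multiplicity, and [v] is a position of [d1].  The guards [0 < d1] and
    [0 < d2] cover the start of a pass: a maximum still at its initial value 0
    need not be attained, and then [v] is stale. *)
Record top_two (D : nat -> nat) (k d1 d2 v : nat) : Prop := TopTwo {
  top_max : forall u, u < k -> D u <= d1;
  top_arg : 0 < d1 -> v < k /\ D v = d1;
  second_max : forall u, u < k -> u != v -> D u <= d2;
  second_arg : 0 < d2 -> exists w, [/\ w < k, w != v & D w = d2];
  second_le : d2 <= d1 }.

Section Memory.
Variable n : nat.
Implicit Type m : nat -> nat.

Lemma cell_lt (i j : nat) : i < n -> j < n -> i * n + j < n * n.
Proof. nia. Qed.

Variable e : rel 'I_n.
Hypothesis simple_e : simple_graph e.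

Definition stores_matrix m := forall i j : 'I_n, m (i * n + j) = e i j.

Definition stores_degrees (S : {set _}) m :=
  forall u : 'I_n, m (n * n + u) = if u \in S then (deg e S u).+1 else 0.

Lemma matrix_le1 m : stores_matrix m -> forall a, a < n * n -> m a <= 1.
Proof.
move=> mA a an; have n_gt0 : 0 < n by lia.
have div_lt : a %/ n < n by rewrite ltn_divLR.
have mod_lt : a %% n < n by rewrite ltn_mod.
by rewrite (divn_eq a n) (mA (Ordinal div_lt) (Ordinal mod_lt)) leq_b1.
Qed.

Lemma graph_input_matrix : stores_matrix (Defs.mem (graph_input e)).
Proof.
move=> i j /=; congr nat_of_bool; apply/existsP/idP => [[i' /existsP[j' /andP[/eqP E]]] | eij].
  have [iE jE] : i = i' /\ j = j'.
    have := congr1 (divn^~ n) E; have := congr1 (modn^~ n) E.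
    have n_gt0 : 0 < n by have := ltn_ord i; lia.
    rewrite /= !modnMDl !divnMDl // !modn_small // !divn_small // !addn0.
    by split; apply: val_inj.
  by rewrite iE jE.
by exists i; apply/existsP; exists j; rewrite eqxx.
Qed.

Lemma row_sum_deg m (i : 'I_n) :
  stores_matrix m -> \sum_(0 <= j < n) m (i * n + j) = deg e setT i.
Proof.
move=> mA; rewrite big_mkord /deg -sum1_card [RHS]big_mkcond.
by apply: eq_bigr => j _; rewrite mA !inE; case: (e i j).
Qed.

Lemma deg_lt S (u : 'I_n) : deg e S u < n.
Proof.
rewrite -[X in _ < X]card_ord -cardsT; apply: proper_card; apply/properP.
by split; [exact: subsetT | exists u; rewrite ?inE // (simple_e.2 u) andbF].
Qed.

Lemma degrees_le S m : stores_degrees S m -> forall u, u < n -> m (n * n + u) <= n.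
Proof. by move=> mD u un; rewrite (mD (Ordinal un)); case: ifP => // _; apply: deg_lt. Qed.

(** The shift by one cancels in the difference, and the zeros of deleted
    vertices lie below every entry of the at least two remaining ones. *)
Lemma top_two_diff S m d1 d2 v :
    stores_degrees S m -> 1 < #|S| -> top_two (fun u => m (n * n + u)) n d1 d2 v ->
  exists x : 'I_n, [/\ x = v :> nat, x \in S, deg e S x = maxdeg e S & diff e S = d1 - d2].
Proof.
move=> mD S_gt1 [tmax targ smax sarg _].
have [x0 x0S _] := exists_maxdeg e (ltnW S_gt1).
have d1_gt0 : 0 < d1 by have := tmax x0 (ltn_ord x0); rewrite mD x0S; lia.
have [vn mv] := targ d1_gt0; pose x := Ordinal vn.
have := mD x; rewrite /= mv; case: ifP => [xS d1E|]; last lia.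
have xmax : deg e S x = maxdeg e S.
  by apply: maxdegP => // u uS; have := tmax u (ltn_ord u); rewrite mD uS d1E.
exists x; split=> //.
have [w wSx [wmax ->]] := diff_witness xS xmax S_gt1.
have /andP[wx wS] : (w != x) && (w \in S) by move: wSx; rewrite !inE.
have := smax w (ltn_ord w) wx; rewrite mD wS => w_le.
have [z [zn zv mz]] := sarg (leq_ltn_trans (leq0n _) w_le).
have := mD (Ordinal zn); rewrite /= mz; case: ifP => [zS d2E|]; last lia.
by have := wmax (Ordinal zn); rewrite !inE zS (_ : Ordinal zn != x) // => /(_ isT); lia.
Qed.

Lemma stores_degrees_del S m m' (x : 'I_n) :
    stores_matrix m -> stores_degrees S m -> x \in S ->
    (forall u : 'I_n, m' (n * n + u)
       = if u == x then 0 else m (n * n + u) - m (u * n + x)) ->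
  stores_degrees (S :\ x) m'.
Proof.
move=> mA mD xS m'E u; rewrite m'E !inE; case: eqVneq => //= ux.
rewrite mA mD; case: ifP => // uS.
have /(deg_setD e u) : [set x] \subset S by rewrite sub1set.
have -> : #|[set y in [set x] | e u y]| = e u x.
  have [eux|neux] := boolP (e u x).
    by apply: etrans (cards1 x); apply: eq_card => y; rewrite !inE; case: eqVneq => // ->.
  by apply: eq_card0 => y; rewrite !inE; case: eqVneq => // ->; apply/negbTE.
by move=> <-; rewrite addnC -addnS addKn.
Qed.

End Memory.

(** * Correctness and cost of the loops *)

Section Program.
Variables (n W : nat).
(** The largest address used is below [n * n + n], and no register exceeds that. *)
Hypothesis W_large : n * n + n < W.
Implicit Types (s : state) (m : nat -> nat).

Ltac run_instr :=
  lazymatch goal with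
  | |- runs _ (Seq (Instr (StoreMem _ _)) _) _ _ _ => apply: runs_instr; [reflexivity|]
  | |- runs _ (Seq (Instr _) _) _ _ _ => apply: runs_write; [reflexivity| |]
  | |- runs _ Skip _ _ _ => apply: runs_skip
  end; rewrite /upd /=.

(** What every loop assumes and preserves once [base] has been computed. *)
Definition setup s :=
  [/\ reg s Reg.n = n, reg s Reg.one = 1, reg s Reg.base = n * n & reg s Reg.zero = 0].

Lemma square_loop_spec s :
    reg s Reg.n = n -> reg s Reg.one = 1 -> reg s Reg.base = 0 ->
    reg s Reg.outer = 0 -> reg s Reg.row = 0 -> reg s Reg.zero = 0 ->
  runs W square_loop s (n * 4).+1
    (fun s' => [/\ setup s', reg s' Reg.row = 0 & Defs.mem s' = Defs.mem s]).
Proof.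
case: s => r m /= rn r1 rb ro rr rz.
pose I k s' := [/\ reg s' Reg.n = n, reg s' Reg.one = 1, reg s' Reg.zero = 0
                 & [/\ reg s' Reg.outer = k, reg s' Reg.base = k * n,
                       reg s' Reg.row = 0 & Defs.mem s' = m]].
apply: (@runs_impl _ _ _ _ (I n)) => [s' [? ? ? []] //|].
apply: (runs_for (I := I)) => [k s' [] ? ? ? [] // | k [r' m'] kn | //].
  move=> [/= rn' r1' rz' [ro' rb' rr' ->]].
  have kn2 : k.+1 * n <= n * n by rewrite leq_mul2r kn orbT.
  do 3?[run_instr; try lia].
  by do !split=> //=; lia.
Qed.

Lemma row_sum_loop_spec s i :
    setup s -> i < n -> (forall a, a < n * n -> Defs.mem s a <= 1) ->
    reg s Reg.row = i * n -> reg s Reg.inner = 0 -> reg s Reg.val = 1 ->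
  runs W row_sum_loop s (n * 6).+1
    (fun s' => [/\ setup s', reg s' Reg.outer = reg s Reg.outer,
                   reg s' Reg.row = i * n, Defs.mem s' = Defs.mem s
                 & reg s' Reg.val = 1 + \sum_(0 <= j < n) Defs.mem s (i * n + j)]).
Proof.
case: s => r m /= [rn r1 rb rz] i_n m01 rr ri rv.
pose I k s' := [/\ setup s', reg s' Reg.inner = k
                 & [/\ reg s' Reg.outer = r Reg.outer, reg s' Reg.row = i * n, Defs.mem s' = m
                     & reg s' Reg.val = 1 + \sum_(0 <= j < k) m (i * n + j)
                       /\ reg s' Reg.val <= k.+1]].
apply: (@runs_impl _ _ _ _ (I n)) => [s' [? _ [? ? ? []]] //|].
apply: (runs_for (I := I)) => [k s' [[? _ _ _] ? _] // | k [r' m'] kn | ].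
    move=> [[/= rn' r1' rb' rz'] ri' [ro' rr' ->]]; rewrite /= in kn *.
    move=> [rv' val_le].
    have addr_lt := cell_lt i_n kn; have cell_le := m01 _ addr_lt.
    do 5?[run_instr; rewrite ?rr' ?ri'; try lia].
    by do !split=> //=; rewrite ?rr' ?ri' ?big_nat_recr //=; lia.
  by do !split=> //=; rewrite ?big_geq // rv.
Qed.

Lemma degree_loop_spec s :
    setup s -> (forall a, a < n * n -> Defs.mem s a <= 1) ->
    reg s Reg.row = 0 -> reg s Reg.outer = 0 ->
  runs W degree_loop s (n * ((n * 6).+1 + 5).+3).+1
    (fun s' => [/\ setup s', forall a, a < n * n -> Defs.mem s' a = Defs.mem s a
                 & forall i, i < n -> Defs.mem s' (n * n + i)
                     = 1 + \sum_(0 <= j < n) Defs.mem s (i * n + j)]).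
Proof.
case: s => r m /= sr m01 rr ro.
pose I k s' := [/\ setup s', reg s' Reg.outer = k, reg s' Reg.row = k * n,
                   forall a, a < n * n -> Defs.mem s' a = m a
                 & forall i, i < k -> Defs.mem s' (n * n + i)
                     = 1 + \sum_(0 <= j < n) m (i * n + j)].
apply: (@runs_impl _ _ _ _ (I n)) => [s' [] //|].
apply: (runs_for (I := I)) => [k s' [[? _ _ _] ? _ _ _] // | k [r' m'] kn | //].
move=> [[/= rn' r1' rb' rz'] ro' rr' mA mD].
do 2![run_instr; try lia].
apply: runs_seq.
  apply: (@row_sum_loop_spec _ k) => //= a an; by rewrite mA ?m01.
case=> r1 m1 [/= [/= rn1 r11 rb1 rz1] ro1 rr1 -> rv1].
have kn2 : k.+1 * n <= n * n by rewrite leq_mul2r kn orbT.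
have rowE : \sum_(0 <= j < n) m' (k * n + j) = \sum_(0 <= j < n) m (k * n + j).
  by apply: eq_big_nat => j /andP[_ jn]; apply/mA/cell_lt.
rewrite rowE in rv1.
do 5?[run_instr; try lia].
do !split=> //=; rewrite ?rb1 ?ro1 ?ro' ?rr1; try lia.
  by move=> a an; rewrite ifN ?mA //; lia.
move=> i ik; case: eqVneq => [E|NE]; last by apply: mD; lia.
by rewrite rv1; have -> : i = k by lia.
Qed.

Lemma scan_loop_spec s :
    setup s -> (forall u, u < n -> Defs.mem s (n * n + u) <= n) ->
    reg s Reg.inner = 0 -> reg s Reg.top = 0 -> reg s Reg.second = 0 ->
  runs W scan_loop s (n * 10).+1
    (fun s' => [/\ [/\ setup s', Defs.mem s' = Defs.mem s, reg s' Reg.outer = reg s Reg.outer,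
                        reg s' Reg.last = reg s Reg.last & reg s' Reg.best = reg s Reg.best],
                   reg s' Reg.top <= n
                 & top_two (fun u => Defs.mem s (n * n + u)) n
                     (reg s' Reg.top) (reg s' Reg.second) (reg s' Reg.arg)]).
Proof.
case: s => r m /= sr mle ri rt rs; set D := fun u => m (n * n + u).
(* i is the counter and k the number of entries read: they differ between the
   test and the increment. *)
pose J i k s' := [/\ [/\ setup s', Defs.mem s' = m, reg s' Reg.outer = r Reg.outer,
                         reg s' Reg.last = r Reg.last & reg s' Reg.best = r Reg.best],
                    reg s' Reg.inner = i, reg s' Reg.top <= n
                  & top_two D k (reg s' Reg.top) (reg s' Reg.second) (reg s' Reg.arg)].
apply: (@runs_impl _ _ _ _ (J n n)) => [s' [] //|].
apply: (runs_for (I := fun k => J k k) (t := (5 + 2).+2))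
  => [k s' [[[? _ _ _] _ _ _ _] ? _ _] // | k [r' m'] kn | ].
  move=> [[[/= rn' r1' rb' rz'] -> ro' rl' rbest'] ri' tn] tt.
  have Dk : D k <= n by apply: mle.
  have [tmax targ smax sarg sle] := tt.
  do 2![run_instr; rewrite ?rb' ?ri' -/(D k); try lia].
  apply: (runs_seq (P := J k k.+1)).
    apply: runs_if => /= [top_lt|top_ge].
      (* A new maximum: the old one becomes second, at its old position. *)
      do 4?[run_instr; rewrite ?rz' ?addn0; try lia].
      do 2!split=> //=; try lia; rewrite ?ri' //; try lia.
      - by move=> u; rewrite ltnS leq_eqVlt => /predU1P[->|/tmax]; lia.
      - by move=> u uk uNk; apply: tmax; lia.
      - by move=> /targ[vk Dv]; exists (r' Reg.arg); split=> //; lia.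
    apply: runs_if => /= [sec_lt|sec_ge]; last first.
      run_instr; split=> //; split=> //=.
      - by move=> u; rewrite ltnS leq_eqVlt => /predU1P[->|/tmax].
      - by move/targ => [? ?]; split=> //; lia.
      - move=> u; rewrite ltnS leq_eqVlt => /predU1P[->|/smax] //.
      - by move=> /sarg[w [? ? ?]]; exists w; split=> //; lia.
    do 2?[run_instr; rewrite ?rz' ?addn0; try lia].
    (* Here 0 < D k <= top, so arg is a genuine earlier position. *)
    have [vk Dv] : r' Reg.arg < k /\ D (r' Reg.arg) = r' Reg.top by apply: targ; lia.
    split=> //; split=> //=.
    - by move=> u; rewrite ltnS leq_eqVlt => /predU1P[->|/tmax].
    - by split=> //; lia.
    - move=> u; rewrite ltnS leq_eqVlt => /predU1P[->|uk uv] //.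
      by have := smax u uk uv; lia.
    - by exists k; split=> //; lia.
  case=> r1 m1 [/= [/= [/= rn1 r11 rb1 rz1] -> ? ? ?] ri1 tn1 tt1].
  do 2?[run_instr; try lia].
  by do !split=> //=; lia.
by split=> //=; rewrite ?rt ?rs //; split.
Qed.

Lemma update_loop_spec s v :
    setup s -> v < n -> (forall u, u < n -> Defs.mem s (n * n + u) <= n) ->
    (forall a, a < n * n -> Defs.mem s a <= 1) ->
    reg s Reg.arg = v -> reg s Reg.inner = 0 -> reg s Reg.row = 0 ->
  runs W update_loop s (n * 10).+1
    (fun s' => [/\ [/\ setup s', reg s' Reg.outer = reg s Reg.outer, reg s' Reg.arg = v,
                        reg s' Reg.last = reg s Reg.last & reg s' Reg.best = reg s Reg.best],
                   forall a, a < n * n -> Defs.mem s' a = Defs.mem s a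
                 & forall u, u < n -> Defs.mem s' (n * n + u)
                     = Defs.mem s (n * n + u) - Defs.mem s (u * n + v)]).
Proof.
case: s => r m /= sr vn mD mA ra ri rr.
pose I k s' := [/\ [/\ setup s', reg s' Reg.outer = r Reg.outer, reg s' Reg.arg = v,
                        reg s' Reg.last = r Reg.last & reg s' Reg.best = r Reg.best],
                   reg s' Reg.inner = k, reg s' Reg.row = k * n,
                   forall a, a < n * n -> Defs.mem s' a = m a
                 & forall u, u < n -> Defs.mem s' (n * n + u)
                     = m (n * n + u) - (if u < k then m (u * n + v) else 0)].
apply: (@runs_impl _ _ _ _ (I n)) => [s' [] ? _ _ ? mu | ].
  by split=> // u un; rewrite mu // un.
apply: (runs_for (I := I)) => [k s' [[[? _ _ _] _ _ _ _] ? _ _ _] // | k [r' m'] kn | ]; last first.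
  by do !split=> //= u un; rewrite subn0.
move=> [[[/= rn' r1' rb' rz'] ro' ra' rl' rbest'] ri' rr' mA' mD'].
have kn2 : k.+1 * n <= n * n by rewrite leq_mul2r kn orbT.
have cell := cell_lt kn vn; have := mA _ cell; have := mD _ kn.
have cellE := mA' _ cell; have degE := mD' _ kn; rewrite ltnn subn0 in degE => Dk_le A_le.
do 9?[run_instr; rewrite ?rb' ?ri' ?rr' ?ra' ?cellE ?degE; try lia].
do !split=> //=; rewrite ?rb' ?ri' ?rr'; try lia.
  by move=> a an; rewrite ifN ?mA' //; lia.
move=> u un; case: eqVneq => [E|NE].
  by have -> : u = k; [lia | rewrite ltnSn].
by rewrite mD' //; congr (_ - _); have -> : (u < k.+1) = (u < k) by lia.
Qed.

Section GreedyLoop.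
Variable e : rel 'I_n.
Hypotheses (n_gt1 : 1 < n) (simple_e : simple_graph e).

(** An optimal deletion is worth either [best], the minimum of the values tried
    so far, or [k] plus the size of a deletion inside the remaining set [S]. *)
Definition greedy_inv k s :=
  [/\ setup s, reg s Reg.outer = k, reg s Reg.last = n - 1, reg s Reg.best <= n - 1
    & stores_matrix e (Defs.mem s) /\
      exists S, [/\ stores_degrees e S (Defs.mem s), #|S| = n - k
                  & minn (reg s Reg.best) (mindel e S + k) = f2 e]].

Lemma greedy_loop_spec s :
  greedy_inv 0 s ->
  runs W greedy_loop s
    ((n - 1) * ((n * 10).+1 + (3 + ((n * 10).+1 + 4).+2).+2).+4).+1
    (greedy_inv (n - 1)).
Proof.
move=> inv0; apply: (runs_for (I := greedy_inv)) inv0 => [k s' [] // | k {s}[r m] kn].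
case=> -[/= rn r1 rb rz] ro rl best_le [mA [S [mD cardS f2E]]].
have S_gt1 : 1 < #|S| by rewrite cardS; lia.
do 3![run_instr; try lia].
apply: runs_seq; first by apply: scan_loop_spec => //=; exact: (degrees_le simple_e mD).
case=> ra ma [/= [[/= ran ra1 rab raz] {ma}-> rao ral rabest] top_le tt].
rewrite ro rl in rao ral; rewrite /= in rabest.
have [x [xv xS xmax diffE]] := top_two_diff mD S_gt1 tt.
have := diff_le simple_e S_gt1; rewrite cardS => diff_le_n.
do 2![run_instr; rewrite -?diffE; try lia].
(* Both branches of the test amount to taking a minimum. *)
apply: (runs_seq (t1 := 3) (P := fun s' =>
  [/\ setup s', Defs.mem s' = m, reg s' Reg.outer = k, reg s' Reg.last = n - 1
    & reg s' Reg.arg = x /\ reg s' Reg.best = minn (r Reg.best) (diff e S + k)])).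
  apply: runs_if => /=.
    rewrite diffE rao rabest => lt_best; do 2?[run_instr; rewrite ?raz ?addn0 -?diffE; try lia].
    by split=> //=; lia.
  by rewrite diffE rao rabest => lt_best; run_instr; split=> //=; lia.
case=> rc mc [/= [/= rcn rc1 rcb rcz] {mc}-> rco rcl [rca rcbest]].
do 2![run_instr; try lia].
apply: runs_seq.
  apply: (@update_loop_spec _ x) => //=; [exact: (degrees_le simple_e mD) | exact: (matrix_le1 mA)].
case=> ru mu [/= [[/= run ru1 rub ruz] ruo rua rul rubest] muA muD].
have xn := ltn_ord x; do 4?[run_instr; try lia].
split=> //=; try lia.
split=> [i j|]; first by rewrite /= ifN ?muA ?mA //; have := cell_lt (ltn_ord i) (ltn_ord j); lia.
exists (S :\ x); split.
- apply: (stores_degrees_del mA mD xS) => u /=.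
  by rewrite rub rua eqn_add2l ruz muD.
- by rewrite subnS -cardS (cardsD1 x S) xS.
- by rewrite -f2E (mindel_rec simple_e S_gt1 xS xmax); lia.
Qed.
End GreedyLoop.
End Program.

Lemma f2_quadratic : computable_in_quadratic_time (fun (n : nat) (e : rel 'I_n) => f2 e).
Proof.
(* Addresses stay below n * n + n, which is less than n ^ 3 as soon as n >= 2;
   100 is a generous factor. *)
exists f2_program, 100, 3 => n e n_gt1 simple_e.
have W_large : n * n + n < n ^ 3 by rewrite !expnS expn0 muln1; nia.
have card_n : 1 < #|[set: 'I_n]| by rewrite cardsT card_ord.
(* The three loops, with the steps between them as the rules count them. *)
pose budget := ((n * 4).+1 + ((n * ((n * 6).+1 + 5).+3).+1
  + (((n - 1) * ((n * 10).+1 + (3 + ((n * 10).+1 + 4).+2).+2).+4).+1 + 2).+3).+1).+1.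
have budget_le : budget <= 100 * n ^ 2 by rewrite /budget expnS expn1; nia.
suff [t [s [ex tle out]]] : runs (n ^ 3) f2_program (graph_input e) budget
    (fun s => reg s 0 = f2 e).
  by exists t, s; split=> //; lia.
have mA := graph_input_matrix e; move: mA; rewrite /graph_input /budget.
set m := (X in State _ X) => mA.
apply: runs_write => //; first lia; rewrite /upd /=.
apply: runs_seq; first exact: square_loop_spec.
case=> r1 m1 [/= [/= ? ? ? ?] ? {m1}->].
apply: runs_write => //; first lia; rewrite /upd /=.
apply: runs_seq.
  by apply: (degree_loop_spec W_large) => //=; exact: (matrix_le1 mA).
case=> r2 m2 [/= [/= r2n r21 r2b r2z] m2A m2D].
do 3![apply: runs_write => //=; rewrite /upd /=; try lia].
apply: runs_seq.
  apply: (greedy_loop_spec W_large n_gt1 simple_e); split=> //=; try lia.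
  have m2E i j : i < n -> j < n -> m2 (i * n + j) = m (i * n + j).
    by move=> i_n jn; apply/m2A/cell_lt.
  split=> [i j|]; first by rewrite m2E.
  exists setT; split; first by move=> u; rewrite m2D // (row_sum_deg _ mA) inE.
    by rewrite cardsT card_ord subn0.
  rewrite r2n r21 r2z !addn0 -f2_mindel; apply/minn_idPr; rewrite f2_mindel.
  apply: leq_trans (mindel_le_diff simple_e card_n) (leq_trans (diff_le simple_e card_n) _).
  by rewrite cardsT card_ord leq_sub2l.
(* After n - 1 rounds the invariant reads minn best (_ + (n - 1)) = f2 e, and
   best <= n - 1. *)
case=> r3 m3 [/= [/= ? ? ? r3z] _ _ best_le [_ [S [_ _ f2E]]]].
apply: runs_write => //=; first lia.
by apply: runs_skip; rewrite /upd /= r3z -f2E; lia.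
Qed.

(* The iterated minimum is started at the term of index j = 0, which belongs  *)
(* to the family, since minn has no neutral element.                          *)
Theorem theorem2p4 :
  (forall (T : finType) (e : rel T) (G : nat -> {set T}) (v : nat -> T),
      simple_graph e -> 2 <= #|T| ->
      G 0 = [set: T] ->
      (forall j, j + 3 <= #|T| ->
         [/\ v j \in G j, deg e (G j) (v j) = maxdeg e (G j)
           & G j.+1 = G j :\ v j]) ->
      f2 e = \big[minn/diff e (G 0) + 0]_(0 <= j < #|T| - 1)
               (diff e (G j) + j))
  /\ computable_in_quadratic_time (fun (n : nat) (e : rel 'I_n) => f2 e).
Proof. by split; [exact: f2_greedy | exact: f2_quadratic]. Qed.
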